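(* Let $M$ be an irreducible highest weight $\widehat{\mathrm{gl}}_{\infty|\infty}$-module with highest weight $\xi\in((\widehat{\mathrm{gl}}_{\infty|\infty})_0)^*$, and let $v_\xi$ be a non-zero highest weight vector. Then the following are equivalent: (i) $M$ is quasi-finite; (ii) $(\widehat{\mathrm{gl}}_{\infty|\infty})_{-\frac12}v_\xi$ is finite dimensional; (iii) there exists $N\in\mathbb N$ such that $\xi=\sum_{j\in\frac12\mathbb Z,\ |j|\le N}\xi_j\omega_j+d\Lambda_0$ for some $\xi_j,d\in\mathbb C$.
   Context: All vector spaces are over $\mathbb C$; $\mathbb N=\{1,2,\dots\}$, $\mathbb Z_+=\{0,1,2,\dots\}$. Let $\mathrm{gl}_{\infty|\infty}$ be the space of complex matrices $(a_{ij})_{i,j\in\frac12\mathbb Z}$ with $a_{ij}=0$ for $|i-j|\gg0$; $e_{pq}$ denotes the matrix unit. It is $\frac12\mathbb Z$-graded: the degree-$k$ component consists of all $\sum_{j\in\frac12\mathbb Z}a_je_{j-k,j}$ ($a_j\in\mathbb C$ arbitrary). Elements of integer degree are even, elements of degree in $\frac12+\mathbb Z$ are odd, and $[A,B]=AB-(-1)^{|A||B|}BA$. Let $J=\sum_{r\le0}e_{rr}$, $\mathrm{Str}(D)=\sum_{r\in\frac12\mathbb Z}(-1)^{2r}d_{rr}$, $\alpha(A,B)=\mathrm{Str}([J,A]B)$. Then $\widehat{\mathrm{gl}}_{\infty|\infty}=\mathrm{gl}_{\infty|\infty}\oplus\mathbb CC$ is the central extension with $C$ even, central, of degree $0$, and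 the bracket of $A,B\in \mathrm{gl}_{\infty|\infty}$ equal to $[A,B]+\alpha(A,B)C$. For a $\frac12\mathbb Z$-graded Lie superalgebra $\mathfrak g=\bigoplus_j\mathfrak g_j$ with $\mathfrak g_0$ abelian, put $\mathfrak g_\pm=\bigoplus_{r>0}\mathfrak g_{\pm r}$. A highest weight module with highest weight $\xi\in\mathfrak g_0^*$ is a module $M$ containing a non-zero vector $v_\xi$ (highest weight vector) with $hv_\xi=\xi(h)v_\xi$ for $h\in\mathfrak g_0$, $\mathfrak g_+v_\xi=0$, $\mathcal U(\mathfrak g_-)v_\xi=M$. It is graded, $M=\bigoplus_{j\in\frac12\mathbb Z_+}M_{-j}$, by giving $v_\xi$ degree $0$. $M$ is quasi-finite if $\dim M_j<\infty$ for all $j$. The weights $\omega_s$ ($s\in\frac12\mathbb Z$) and $\Lambda_0$ in $((\widehat{\mathrm{gl}}_{\infty|\infty})_0)^*$ are defined by $\omega_s(\sum_ra_re_{rr}+dC)=a_s$, $\Lambda_0(\sum_ra_re_{rr}+dC)=d$. *)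

(* Defs.v *)
From HB Require Import structures.
From mathcomp Require Import all_boot all_order all_algebra.
From mathcomp Require Import complex.
From mathcomp Require Import all_classical all_reals.

Set Implicit Arguments.
Unset Strict Implicit.
Unset Printing Implicit Defensive.

Import Order.TTheory GRing.Theory Num.Theory.
Local Open Scope classical_set_scope.
Local Open Scope ring_scope.

(* Half-integers are encoded by their doubles: r in (1/2)Z is represented by
   2r : int. This applies to matrix indices, to degrees and to the indices of
   the weights omega_s. The complex numbers are R[i] for R : realType. *)

(* The parity of a half-integer degree k, i.e. the parity of the integer 2k. *)
Definition oddz (k : int) : bool := odd `|k|%N.

Section Span.
Context {K : pzRingType} {V : lmodType K}.

Definition lspan (S : set V) : set V :=
  [set u | exists n (a : 'I_n -> K) (w : 'I_n -> V),
     (forall i, S (w i)) /\ u = \sum_(i < n) a i *: w i].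

Definition findim (W : set V) : Prop :=
  exists s : seq V, W = lspan [set` s].

End Span.

Section Gl.
Context (R : realType).
Local Notation C := R[i].
Local Notation mat := (int -> int -> C^o).

Definition banded : {pred mat} :=
  mem [set a : mat | exists n : nat, forall i j, n%:Z < `|i - j| -> a i j = 0].

Lemma bandedP (a : mat) :
  (exists n : nat, forall i j, n%:Z < `|i - j| -> a i j = 0) <-> a \in banded.
Proof. by split=> [h|/set_mem//]; apply/mem_set. Qed.

Lemma banded_submod_closed : submod_closed banded.
Proof.
split; first by apply/bandedP; exists 0%N.
move=> c a b /bandedP[m hm] /bandedP[n hn]; apply/bandedP.
exists (maxn m n) => i j hij; rewrite !fctE hm ?hn ?scaler0 ?addr0 //.
- by apply: le_lt_trans hij; rewrite lez_nat leq_maxr.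
- by apply: le_lt_trans hij; rewrite lez_nat leq_maxl.
Qed.

HB.instance Definition _ :=
  GRing.isSubmodClosed.Build C mat banded banded_submod_closed.

Record gl := Gl { glval :> mat; glvalP : glval \in banded }.

HB.instance Definition _ := [isSub for glval].
HB.instance Definition _ := [Choice of gl by <:].
HB.instance Definition _ := [SubChoice_isSubLmodule of gl by <:].

Definition gl_deg (k : int) (A : gl) : Prop :=
  forall i j, j - i != k -> A i j = 0.

Lemma gl_mul_subproof (A B : gl) :
  (fun i j => \sum_(k \in [set: int]) A i k * B k j : C^o) \in banded.
Proof.
have [/bandedP[m hm] /bandedP[n hn]] := (glvalP A, glvalP B).
apply/bandedP; exists (m + n)%N => i j hij; apply: fsbig1 => k _.
have [hik|hik] := ltP m%:Z `|i - k|; first by rewrite hm// mul0r.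
rewrite [X in _ * X]hn ?mulr0//.
have := ler_distD k i j; move: hij hik; rewrite PoszD => h1 h2 h3.
by rewrite -(ltrD2l m%:Z); apply/(lt_le_trans h1)/(le_trans h3); rewrite lerD2r.
Qed.

Definition gl_mul (A B : gl) : gl := Gl (gl_mul_subproof A B).

Lemma gl_part_subproof (s : bool) (A : gl) :
  (fun i j => if oddz (j - i) == s then A i j else 0 : C^o) \in banded.
Proof.
have /bandedP[m hm] := glvalP A; apply/bandedP; exists m => i j hij.
by rewrite hm//; case: ifP.
Qed.

(* The even (s = false) or odd (s = true) component of A. *)
Definition gl_part (s : bool) (A : gl) : gl := Gl (gl_part_subproof s A).

(* The bilinear extension of AB - (-1)^(|A||B|) BA for homogeneous A, B. *)
Definition gl_bracket (A B : gl) : gl :=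
  \sum_(s : bool) \sum_(t : bool)
    (gl_mul (gl_part s A) (gl_part t B)
     - (-1) ^+ (s && t) *: gl_mul (gl_part t B) (gl_part s A)).

Lemma gl_part_homog (s : bool) k (A : gl) :
  gl_deg k A -> gl_part s A = if oddz k == s then A else 0.
Proof.
move=> hA; apply/val_inj/funext => i; apply/funext => j /=.
have [<-|ne] := eqVneq (j - i) k; first by case: ifP.
by rewrite hA// !if_same; case: ifP => // _; rewrite hA.
Qed.

Lemma gl_mul0l (A : gl) : gl_mul 0 A = 0.
Proof.
apply/val_inj/funext => i; apply/funext => j /=.
by apply: fsbig1 => k _; rewrite mul0r.
Qed.

Lemma gl_mul0r (A : gl) : gl_mul A 0 = 0.
Proof.
apply/val_inj/funext => i; apply/funext => j /=.
by apply: fsbig1 => k _; rewrite mulr0.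
Qed.

Lemma gl_bracket_homog k l (A B : gl) : gl_deg k A -> gl_deg l B ->
  gl_bracket A B =
    gl_mul A B - (-1) ^+ (oddz k && oddz l) *: gl_mul B A.
Proof.
move=> hA hB; rewrite /gl_bracket !big_bool !(gl_part_homog _ hA).
rewrite !(gl_part_homog _ hB).
by case: (oddz k); case: (oddz l);
  rewrite /= !(gl_mul0l, gl_mul0r, scaler0, oppr0, addr0, add0r).
Qed.

Lemma glJ_subproof :
  (fun i j : int => ((i == j) && (i <= 0))%:R : C^o) \in banded.
Proof.
apply/bandedP; exists 0%N => i j; rewrite normr_gt0 subr_eq0.
by move=> /negbTE ->.
Qed.

Definition glJ : gl := Gl glJ_subproof.

(* The sum is 0 by convention when the diagonal has infinite support; in the
   cocycle below it is finite, since [J, A] has finitely many non-zero entries. *)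
Definition Str (D : gl) : C :=
  \sum_(r \in [set: int]) (-1) ^+ oddz r * D r r.

Definition gl_cocycle (A B : gl) : C := Str (gl_mul (gl_bracket glJ A) B).

(* The pair (A, d) stands for A + d C. *)
Definition ghat : lmodType C := (gl * C^o)%type.

Definition ghat_bracket (x y : ghat) : ghat :=
  (gl_bracket x.1 y.1, gl_cocycle x.1 y.1).

Definition ghat_deg (k : int) : set ghat :=
  [set x | gl_deg k x.1 /\ (k != 0 -> x.2 = 0)].

Definition ghat_pos : set ghat :=
  lspan [set x | exists2 k : int, 0 < k & ghat_deg k x].

Definition ghat_neg : set ghat :=
  lspan [set x | exists2 k : int, k < 0 & ghat_deg k x].

Definition ghat_deg0 : {pred ghat} := mem (ghat_deg 0).

Lemma ghat_deg0_submod_closed : submod_closed ghat_deg0.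
Proof.
split; first by apply/mem_set.
move=> c x y /set_mem[hx _] /set_mem[hy _]; apply/mem_set; split=> //= i j hij.
by rewrite /= !fctE hx ?hy// scaler0 addr0.
Qed.

HB.instance Definition _ :=
  GRing.isSubmodClosed.Build C ghat ghat_deg0 ghat_deg0_submod_closed.

Record ghat0 := Ghat0 { ghat0val :> ghat; ghat0valP : ghat0val \in ghat_deg0 }.

HB.instance Definition _ := [isSub for ghat0val].
HB.instance Definition _ := [Choice of ghat0 by <:].
HB.instance Definition _ := [SubChoice_isSubLmodule of ghat0 by <:].

Definition omega (s : int) (h : ghat0) : C^o := (val h).1 s s.

Definition Lambda0 (h : ghat0) : C^o := (val h).2.

Record ghat_module := GhatModule {
  carrier :> lmodType C;
  mod_part : bool -> set carrier;
  mod_part_submod : forall s, submod_closed (mem (mod_part s));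
  mod_part_direct : forall m, exists! p : carrier * carrier,
    [/\ mod_part false p.1, mod_part true p.2 & m = p.1 + p.2];
  act : ghat -> carrier -> carrier;
  act_linear_l : forall m, linear (act^~ m);
  act_linear_r : forall x, linear (act x);
  act_part : forall k x s m, ghat_deg k x -> mod_part s m ->
    mod_part (s (+) oddz k) (act x m);
  act_bracket : forall k l x y m, ghat_deg k x -> ghat_deg l y ->
    act (ghat_bracket x y) m =
      act x (act y m) - (-1) ^+ (oddz k && oddz l) *: act y (act x m)
}.

Section Modules.
Variable M : ghat_module.

Definition submodule (W : set M) : Prop :=
  [/\ submod_closed (mem W),
      forall m, W m -> exists m0 m1,
        [/\ mod_part false m0 /\ W m0, mod_part true m1 /\ W m1 & m = m0 + m1]
    & forall x m, W m -> W (act x m)].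

Definition irreducible_module : Prop :=
  (exists m : M, m <> 0) /\
  forall W : set M, submodule W -> W = [set 0] \/ W = setT.

(* U(g_-) v, spanned by the vectors x_1 ... x_n v with all x_i in g_-. *)
Definition Uneg (v : M) : set M :=
  lspan [set foldr (@act M) v s | s in [set s : seq ghat |
    forall x, x \in s -> ghat_neg x]].

Definition highest_weight_vector (xi : {linear ghat0 -> C^o}) (v : M) : Prop :=
  [/\ v <> 0,
      forall h : ghat0, act (val h) v = (xi h : C) *: v,
      forall x, ghat_pos x -> act x v = 0
    & Uneg v = setT].

(* lowered v j m: m is a monomial x_1 ... x_n v with homogeneous x_i in
   g_-, of total degree j; the empty monomial v has degree 0. *)
Inductive lowered (v : M) : int -> M -> Prop :=
| lowered_nil : lowered v 0 v
| lowered_cons k x j m : k < 0 -> ghat_deg k x -> lowered v j m ->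
    lowered v (k + j) (act x m).

(* The degree-j component of M in the grading giving v degree 0. *)
Definition mod_deg (v : M) (j : int) : set M := lspan (lowered v j).

Definition quasi_finite (v : M) : Prop := forall j, findim (mod_deg v j).

End Modules.

End Gl.

(* Main.v *)
(* If g_(-1/2) v has dimension n, then some non-zero polynomial p of degree at
   most n makes x = sum_j p(j) e_(j+1,j) kill v (doubled indices). Since p has
   finitely many zeros, the products of its values with arbitrary coefficients
   reach every sequence c vanishing near the origin, and bracketing x with
   degree 1/2 shows that the weight kills sum_j c_j (e_jj + e_(j+1,j+1)), hence
   every diagonal matrix supported far away.

   Conversely, let the weight be finitely supported. The vectors x v, with x of
   negative degree and supported far from the origin, span a space stable under
   degrees >= 0: the bracket of such an x with y is again far from the origin,
   and its diagonal part is killed by the weight and the cocycle. These vectors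
   thus generate a submodule in negative degrees, so they vanish. The degree is
   detected by the action of diag(j), whose eigenvalues separate the graded
   components. Commuting x through monomials, far elements kill every monomial
   in v, so each lowering step only produces finitely many new directions. *)

Require Import Defs.
From HB Require Import structures.
From mathcomp Require Import all_boot all_order all_algebra.
From mathcomp Require Import complex.
From mathcomp Require Import all_classical all_reals.
From mathcomp Require Import zify.

Set Implicit Arguments.
Unset Strict Implicit.
Unset Printing Implicit Defensive.

Import Order.TTheory GRing.Theory Num.Theory.
Local Open Scope classical_set_scope.
Local Open Scope ring_scope.

(** * Subspaces and spans *)

Section LinearSpan.
Context {K : pzRingType} {V : lmodType K}.
Implicit Types (S W : set V) (u : V).

Definition subspace W : Prop :=
  W 0 /\ forall a u w, W u -> W w -> W (a *: u + w).

Lemma subspaceP W : subspace W <-> submod_closed (mem W).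
Proof.
split=> -[W0 WD]; split.
- exact/mem_set.
- by move=> a u w /set_mem Wu /set_mem Ww; apply/mem_set/WD.
- exact/set_mem.
- by move=> a u w Wu Ww; apply/set_mem/WD; apply/mem_set.
Qed.

Lemma subspaceZ W a u : subspace W -> W u -> W (a *: u).
Proof. by move=> [W0 WD] Wu; rewrite -[_ *: _]addr0; apply: WD. Qed.

Lemma subspaceD W u w : subspace W -> W u -> W w -> W (u + w).
Proof. by move=> [_ WD] Wu Ww; rewrite -[u]scale1r; apply: WD. Qed.

Lemma subspaceN W u : subspace W -> W u -> W (- u).
Proof. by move=> subW Wu; rewrite -scaleN1r; apply: subspaceZ. Qed.

Lemma subspace_sum W (I : Type) (r : seq I) (P : pred I) (F : I -> V) :
  subspace W -> (forall i, P i -> W (F i)) -> W (\sum_(i <- r | P i) F i).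
Proof.
move=> subW WF; apply: big_ind => //; first by case: subW.
by move=> u w; apply: subspaceD.
Qed.

Lemma lspan_subspace S : subspace (lspan S).
Proof.
split; first by exists 0%N, (fun=> 0), (fun=> 0); split; [case|rewrite big_ord0].
move=> a _ _ [m [b [u [Su ->]]]] [n [c [w [Sw ->]]]].
exists (m + n)%N.
exists (fun i => match fintype.split i with inl j => a * b j | inr j => c j end).
exists (fun i => match fintype.split i with inl j => u j | inr j => w j end).
split; first by move=> i; case: fintype.split.
rewrite big_split_ord scaler_sumr; congr (_ + _); apply: eq_bigr => i _ /=.
  by rewrite (unsplitK (inl i)) scalerA.
by rewrite (unsplitK (inr i)).
Qed.

Lemma lspan_incl S : S `<=` lspan S.
Proof.
move=> u Su; exists 1%N, (fun=> 1), (fun=> u); split=> //.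
by rewrite big_ord1 scale1r.
Qed.

Lemma lspan_min S W : subspace W -> S `<=` W -> lspan S `<=` W.
Proof.
move=> subW SW _ [n [a [w [Sw ->]]]]; apply: subspace_sum => // i _.
by apply: subspaceZ => //; apply: SW.
Qed.

Lemma lspan_mono S S' : S `<=` S' -> lspan S `<=` lspan S'.
Proof.
move=> SS'; apply: lspan_min; first exact: lspan_subspace.
exact: subset_trans (@lspan_incl _).
Qed.

Lemma lspan_id W : subspace W -> lspan W = W.
Proof.
by move=> subW; apply/seteqP; split; [exact: lspan_min | exact: lspan_incl].
Qed.

Lemma lspan_seq (s : seq V) u : lspan [set` s] u ->
  exists a : 'I_(size s) -> K, u = \sum_(i < size s) a i *: s`_i.
Proof.
move: u; apply: (@lspan_min _ [set u | exists a : 'I_(size s) -> K,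
  u = \sum_(i < size s) a i *: s`_i]).
  split; first by exists (fun=> 0); rewrite big1// => i _; rewrite scale0r.
  move=> c _ _ [a ->] [b ->]; exists (fun i => c * a i + b i).
  rewrite scaler_sumr -big_split; apply: eq_bigr => i _.
  by rewrite scalerDl scalerA.
move=> u /= us; have lt_us : (index u s < size s)%N by rewrite index_mem.
exists (fun i => (i == Ordinal lt_us)%:R).
rewrite (bigD1 (Ordinal lt_us))//= eqxx scale1r nth_index// big1 ?addr0//.
by move=> i /negbTE ->; rewrite scale0r.
Qed.

Lemma findim_lspan S (s : seq V) :
  [set` s] `<=` lspan S -> S `<=` lspan [set` s] -> findim (lspan S).
Proof.
by move=> sS Ss; exists s; apply/seteqP; split;
  apply: lspan_min => //; apply: lspan_subspace.
Qed.

End LinearSpan.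

(** The coefficient matrix over [s] has more rows than columns, so a non-zero row vector annihilates
    it. *)
Lemma dependent_images (F : fieldType) (V : lmodType F) (n : nat) (s : seq V)
    (w : 'I_n -> V) : (size s < n)%N -> (forall i, lspan [set` s] (w i)) ->
  exists2 a : 'I_n -> F, exists i, a i != 0 & \sum_(i < n) a i *: w i = 0.
Proof.
move=> ltsn sw; have [b wE] := choice (fun i => lspan_seq (sw i)).
pose A := \matrix_(i < n, j < size s) b i j.
have kerA : kermx A != 0.
  by rewrite -mxrank_eq0 mxrank_ker subn_eq0 -ltnNge (leq_ltn_trans (rank_leq_col A)).
have /rowV0Pn[a /sub_kermxP aA a0] := kerA.
exists (fun i => a 0 i).
  apply/existsP; apply: contra_neqT a0 => /existsPn a0.
  by apply/rowP => i; rewrite mxE; apply/eqP/negbNE/a0.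
under eq_bigr do rewrite wE scaler_sumr.
rewrite exchange_big big1// => j _ /=.
under eq_bigr do rewrite scalerA.
rewrite -scaler_suml; have /rowP/(_ j) := aA; rewrite !mxE.
by under eq_bigr do rewrite mxE; move=> ->; rewrite scale0r.
Qed.

(** Induction on the size: integer roots are split off one at a time, and the bound grows to cover
    each. *)
Lemma poly_int_roots_bounded (F : numFieldType) (p : {poly F}) : p != 0 ->
  exists N : nat, forall j : int, N%:Z < `|j| -> p.[j%:~R] != 0.
Proof.
elim: {p}(size p) {-2}p (erefl (size p)) => [p /eqP|n IHn p sp p0].
  by rewrite size_poly_eq0 => ->.
have [[j /factor_theorem[q pE]]|noroot] := pselect (exists j : int, root p j%:~R);
  last by exists 0%N => j _; apply/negP => rj; apply: noroot; exists j.
have q0 : q != 0 by apply: contra_neq p0 => q0; rewrite pE q0 mul0r.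
have sq : size q = n.
  by move: sp; rewrite pE size_Mmonic ?monicXsubC// size_XsubC addn2 => -[].
have [N qN] := IHn _ sq q0; exists (maxn N `|j|)%N => i ltNi.
rewrite pE hornerM mulf_neq0 ?qN//; first lia.
rewrite !hornerE subr_eq0 eqr_int; lia.
Qed.

(** The recursion [c i = h i - c (i - 1)] is solved outward from [c 0 = 0] in both directions; [c]
    stays zero as long as [h] does. *)
Lemma alternating_primitive (V : zmodType) (h : int -> V) (N : int) :
  (forall i, `|i| <= N -> h i = 0) ->
  exists2 c : int -> V, (forall i, c i + c (i - 1) = h i) &
    forall i, `|i| <= N -> c i = 0.
Proof.
move=> hN.
pose cp := fix cp n := if n is m.+1 then h m.+1%:Z - cp m else 0 : V.
(* [cn n] is the value at [- (n + 1)], so its base case is [h 0 - c 0]. *)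
pose cn := fix cn n := if n is m.+1 then h (Negz m) - cn m else h 0 : V.
exists (fun i => match i with Posz n => cp n | Negz n => cn n end).
  move=> [[|n]|n].
  - by rewrite [0%N%:Z - 1](_ : _ = Negz 0)//= add0r.
  - by rewrite [n.+1%:Z - 1](_ : _ = n%:Z)/=; [rewrite subrK | lia].
  - by rewrite [Negz n - 1](_ : _ = Negz n.+1)/=; [rewrite addrC subrK | lia].
case; elim=> [|n IHn] ltnN //=.
- by rewrite hN// IHn ?subrr//; lia.
- by rewrite hN//; lia.
- by rewrite hN ?IHn ?subrr//; lia.
Qed.

Lemma fsbig_single (T : choiceType) (V : nmodType) (a : T) (f : T -> V) :
  (forall k, k != a -> f k = 0) -> \sum_(k \in [set: T]) f k = f a.
Proof.
move=> f0; rewrite -(@fsbig_widen _ _ _ _ [set a] [set: T])// ?fsbig_set1//.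
by move=> k [_ /eqP ka]; apply: f0.
Qed.

Lemma int_ball (n : nat) :
  exists2 r : seq int, uniq r & forall j, (j \in r) = (`|j| <= n%:Z).
Proof.
exists [seq k%:Z - n%:Z | k <- iota 0 (2 * n).+1].
  by rewrite map_inj_uniq ?iota_uniq// => k l; lia.
move=> j; apply/mapP/idP => [[k]|jn]; first by rewrite mem_iota; lia.
by exists (absz (j + n%:Z)); rewrite ?mem_iota; lia.
Qed.

(** * Brackets and the cocycle in coordinates *)

Section Algebra.
Context (R : realType).
Local Notation C := R[i].
Implicit Types (A B : gl R) (x y : ghat R) (h : ghat0 R) (a b c : int -> C).

Lemma gl_ext A B : (forall i j, A i j = B i j) -> A = B.
Proof.
by move=> AB; apply/val_inj/funext => i; apply/funext => j; apply: AB.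
Qed.

(** A homogeneous left factor leaves one intermediate index, so the sum over all integers becomes a
    single term. *)
Lemma gl_mul_degl k A B i j :
  gl_deg k A -> gl_mul A B i j = A i (i + k) * B (i + k) j.
Proof.
move=> degA; rewrite /= (fsbig_single (a := i + k))// => m mk.
by rewrite degA ?mul0r//; lia.
Qed.

Lemma gl_bracketE k l A B i j : gl_deg k A -> gl_deg l B ->
  gl_bracket A B i j = A i (i + k) * B (i + k) j
    - (-1) ^+ (oddz k && oddz l) * (B i (i + l) * A (i + l) j).
Proof.
move=> degA degB; rewrite (gl_bracket_homog degA degB).
by rewrite -(gl_mul_degl _ i j degA) -(gl_mul_degl _ i j degB).
Qed.

Lemma gl_bracket_deg k l A B :
  gl_deg k A -> gl_deg l B -> gl_deg (k + l) (gl_bracket A B).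
Proof.
move=> degA degB i j ij; rewrite (gl_bracketE _ _ degA degB).
rewrite [X in _ * X - _]degB; last lia.
by rewrite [X in _ - _ * (_ * X)]degA ?mulr0 ?subr0//; lia.
Qed.

Lemma glJ_deg : gl_deg 0 (glJ R).
Proof. by move=> i j ij /=; have /negbTE -> : i != j by lia. Qed.

Lemma glJ_bracketE l B i j : gl_deg l B ->
  gl_bracket (glJ R) B i j = ((i <= 0)%R%:R - (j <= 0)%R%:R) * B i j.
Proof.
move=> degB; have [/eqP lE|ij] := boolP (j - i == l); last first.
  by rewrite (gl_bracket_deg glJ_deg degB) ?degB ?mulr0// add0r.
rewrite (gl_bracketE _ _ glJ_deg degB) addr0 /= !eqxx expr0 mul1r.
rewrite (_ : i + l = j) ?eqxx /=; last lia.
by rewrite mulrBl [X in _ - X]mulrC.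
Qed.

(** The two indicators differ only when [r] and [r + k] lie on opposite sides of the cut of [J] at
    0, hence for finitely many [r]. *)
Lemma gl_cocycleE k A B : gl_deg k A -> gl_cocycle A B =
  \sum_(r \in [set: int]) (-1) ^+ oddz r *
    (((r <= 0)%R%:R - (r + k <= 0)%R%:R) * A r (r + k) * B (r + k) r).
Proof.
move=> degA; apply: eq_fsbigr => r _; congr (_ * _).
have degJA := gl_bracket_deg glJ_deg degA; rewrite add0r in degJA.
by rewrite (gl_mul_degl _ _ _ degJA) (glJ_bracketE _ _ degA).
Qed.

Lemma gl_cocycle_degD k l A B :
  gl_deg k A -> gl_deg l B -> k + l != 0 -> gl_cocycle A B = 0.
Proof.
move=> degA degB kl; rewrite (gl_cocycleE _ degA); apply: fsbig1 => r _.
by rewrite degB ?mulr0//; lia.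
Qed.

Lemma ghat_bracket_deg k l x y : ghat_deg k x -> ghat_deg l y ->
  ghat_deg (k + l) (ghat_bracket x y).
Proof.
move=> [degx _] [degy _]; split; first exact: gl_bracket_deg.
exact: gl_cocycle_degD.
Qed.

Lemma ghat_deg_subspace k : subspace (@ghat_deg R k).
Proof.
split=> [|c x y [x1 x2] [y1 y2]]; split=> //= [i j ij|k0].
  by rewrite /= !fctE x1 ?y1// scaler0 addr0.
by rewrite x2 ?y2// scaler0 addr0.
Qed.

Lemma gldiag_subproof k a :
  (fun i j : int => if j - i == k then a j else 0 : C^o) \in @banded R.
Proof.
apply/bandedP; exists `|k|%N => i j kij.
by have /negbTE -> : j - i != k by lia.
Qed.

(* The matrix [\sum_j a j * e_(j-k, j)]. *)
Definition gldiag k a : gl R := Gl (gldiag_subproof k a).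

Lemma gldiag_deg k a : gl_deg k (gldiag k a).
Proof. by move=> i j ij /=; rewrite (negbTE ij). Qed.

Lemma gl_degE k A : gl_deg k A -> A = gldiag k (fun j => A (j - k) j).
Proof.
move=> degA; apply: gl_ext => i j /=; case: eqP => [<-|/eqP/degA//].
by congr (A _ _); lia.
Qed.

Definition ghdiag k a : ghat R := (gldiag k a, 0).

Lemma ghdiag_deg k a : ghat_deg k (ghdiag k a).
Proof. by split=> //; apply: gldiag_deg. Qed.

Lemma ghdiag_sum k (I : Type) (r : seq I) (F : I -> int -> C) (e : I -> C) :
  \sum_(i <- r) e i *: ghdiag k (F i) =
    ghdiag k (fun j => \sum_(i <- r) e i * F i j).
Proof.
elim: r => [|i r IHr].
  rewrite big_nil; congr pair; apply: gl_ext => i j /=.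
  by rewrite big_nil if_same.
rewrite big_cons IHr; congr pair; last by rewrite /= scaler0 addr0.
apply: gl_ext => m n; rewrite /= !fctE /=; case: eqP => _.
  by rewrite big_cons.
by rewrite scaler0 addr0.
Qed.

Lemma gl_sumE (I : Type) (r : seq I) (F : I -> gl R) i j :
  (\sum_(m <- r) F m) i j = \sum_(m <- r) F m i j.
Proof. by elim/big_rec2: _ => // m _ A _ <-. Qed.

(** A banded matrix is the sum of its finitely many diagonals; the central part has degree 0. *)
Lemma ghat_homog_sum x : lspan [set y | exists k, ghat_deg k y] x.
Proof.
case: x => A d; have /bandedP[n nA] := glvalP A.
pose part m : gl R := gldiag (m%:Z - n%:Z) (fun j => A (j - (m%:Z - n%:Z)) j).
have -> : (A, d) = (0, d) + \sum_(m <- index_iota 0 (n.*2).+1) (part m, 0)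
    :> ghat R.
  rewrite [\sum_(_ <- _) _]surjective_pairing !(raddf_sum fst) !(raddf_sum snd).
  congr pair; last by rewrite /= big1 ?addr0.
  apply: gl_ext => i j; rewrite add0r gl_sumE.
  transitivity (\sum_(m <- index_iota 0 (n.*2).+1)
      if m%:Z == j - i + n%:Z then A i j else 0); last first.
    apply: eq_bigr => m _ /=; case: eqP => mE; last by rewrite ifF//; lia.
    by rewrite ifT; [congr (A _ _); lia | lia].
  rewrite -big_mkcond /=; have [nij|nij] := ltrP n%:Z `|i - j|.
    by rewrite nA// big1.
  rewrite (eq_bigl (eq_op^~ (absz (j - i + n%:Z)))); last by move=> m /=; lia.
  by rewrite big_nat1_eq ifT//; lia.
apply: subspaceD; first exact: lspan_subspace.
  by apply: lspan_incl; exists 0; split.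
apply: subspace_sum; first exact: lspan_subspace.
move=> m _; apply: lspan_incl; exists (m%:Z - n%:Z).
exact: ghdiag_deg.
Qed.

(** An inner degree operator: the diagonal entries are the doubled indices, so its eigenvalues are
    the doubled degrees up to sign. *)
Definition grading : ghat R := ghdiag 0 (fun j => j%:~R).

Lemma grading_bracket k x : k != 0 -> ghat_deg k x ->
  ghat_bracket grading x = (- k)%:~R *: x.
Proof.
move=> k0 degx; have [deg1 deg2] := degx.
have [_ /=] := ghat_bracket_deg (ghdiag_deg 0 (fun j => j%:~R)) degx.
rewrite add0r => /(_ k0) cocyc.
rewrite [LHS]surjective_pairing [RHS]surjective_pairing; congr pair; last first.
  by rewrite /= deg2// scaler0; exact: cocyc.
have deg0 : gl_deg 0 grading.1 by exact: gldiag_deg.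
apply: gl_ext => i j; rewrite (gl_bracketE _ _ deg0 deg1) expr0 mul1r.
rewrite [RHS](_ : _ = (- k)%:~R * x.1 i j)//=.
have [/eqP kE|kij] := boolP (j - i == k); last first.
  by rewrite addr0 deg1// !mulr0 ifF ?mulr0 ?subrr//; lia.
rewrite addr0 (_ : i + k = j); last lia.
by rewrite !subrr eqxx [X in _ - X]mulrC -mulrBl -mulrzBr -kE opprB.
Qed.

(** * Elements supported far from the origin *)

(* Both quadrants are disjoint from the support of the weight for large n, and
   the cocycle only sees the entries outside of them. *)
Definition far (n : nat) A : Prop := forall i j,
  ~~ ((n%:Z <= i) && (n%:Z <= j) || (i <= - n%:Z) && (j <= - n%:Z)) -> A i j = 0.

Lemma far_le m n A : (m <= n)%N -> far n A -> far m A.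
Proof. by move=> mn farA i j mij; apply: farA; lia. Qed.

(** A non-zero term contains an entry of [A], one of whose indices is moved by [l]. For [l >= 0] it
    stays between the two indices of that entry, since [k + l <= 0]; for [l < 0] it comes closer to
    the origin by at most [- l], which [m] must absorb. *)
Lemma far_bracket m n k l A B : gl_deg k A -> gl_deg l B -> far m A ->
  k <= 0 -> k + l <= 0 -> n%:Z <= m%:Z -> n%:Z - l <= m%:Z ->
  far n (gl_bracket A B) /\ far n (gl_bracket B A).
Proof.
move=> degA degB farA k0 kl nm nlm.
have farAB i j :
    ~~ ((n%:Z <= i) && (n%:Z <= j) || (i <= - n%:Z) && (j <= - n%:Z)) ->
    A i (i + k) * B (i + k) j = 0.
  have [/eqP ij|ij] := boolP (j - i == k + l); last first.
    by rewrite degB ?mulr0//; lia.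
  by move=> nij; rewrite farA ?mul0r//; lia.
have farBA i j :
    ~~ ((n%:Z <= i) && (n%:Z <= j) || (i <= - n%:Z) && (j <= - n%:Z)) ->
    B i (i + l) * A (i + l) j = 0.
  have [/eqP ij|ij] := boolP (j - i == k + l); last first.
    by rewrite degA ?mulr0//; lia.
  by move=> nij; rewrite farA ?mulr0//; lia.
split=> i j nij;
  rewrite (gl_bracketE _ _ degA degB) || rewrite (gl_bracketE _ _ degB degA);
  by rewrite farAB// farBA// mulr0 subr0.
Qed.

(** A term of the cocycle needs indices on opposite sides of the cut, whereas both indices of a far
    entry are on one side. Positivity of [n] keeps the index 0 out of the positive quadrant. *)
Lemma gl_cocycle_far n k A B : (0 < n)%N -> gl_deg k A -> far n B ->
  gl_cocycle A B = 0.
Proof.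
move=> n0 degA farB; rewrite (gl_cocycleE _ degA); apply: fsbig1 => r _.
have [rr|rr] := boolP ((r <= 0) == (r + k <= 0)).
  by rewrite (eqP rr) subrr !mul0r mulr0.
by rewrite farB ?mulr0//; lia.
Qed.

End Algebra.

(** * Annihilators of the highest weight vector *)

Section HighestWeight.
Context (R : realType) (M : ghat_module R).
Local Notation C := R[i].
Implicit Types (x y : ghat R) (m : M).

Lemma actP x a m n : act x (a *: m + n) = a *: act x m + act x n.
Proof. exact: act_linear_r. Qed.

Lemma actDr x m n : act x (m + n) = act x m + act x n.
Proof. by rewrite -[m]scale1r actP !scale1r. Qed.

Lemma act0r x : act x 0 = 0 :> M.
Proof. by apply: (addIr (act x 0)); rewrite -actDr !add0r. Qed.

Lemma actZr x a m : act x (a *: m) = a *: act x m.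
Proof. by rewrite -[a *: m]addr0 actP act0r addr0. Qed.

Lemma actNr x m : act x (- m) = - act x m.
Proof. by rewrite -scaleN1r actZr scaleN1r. Qed.

Lemma actPl m a x y : act (a *: x + y) m = a *: act x m + act y m.
Proof. exact: act_linear_l. Qed.

Lemma actDl m x y : act (x + y) m = act x m + act y m.
Proof. by rewrite -[x]scale1r actPl !scale1r. Qed.

Lemma act0l m : act 0 m = 0.
Proof. by apply: (addIr (act 0 m)); rewrite -actDl !add0r. Qed.

Lemma actZl m a x : act (a *: x) m = a *: act x m.
Proof. by rewrite -[a *: x]addr0 actPl act0l addr0. Qed.

Lemma act_suml m (I : Type) (r : seq I) (F : I -> ghat R) :
  act (\sum_(i <- r) F i) m = \sum_(i <- r) act (F i) m.
Proof.
elim: r => [|i r IHr]; first by rewrite !big_nil act0l.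
by rewrite !big_cons actDl IHr.
Qed.

Lemma subspace_act_preim (W : set M) x :
  subspace W -> subspace [set m | W (act x m)].
Proof.
move=> [W0 WD]; split=> [|a m n Wm Wn]; first by rewrite /= act0r.
by rewrite /= actP; apply: WD.
Qed.

Lemma subspace_orbit_preim (W : set M) m :
  subspace W -> subspace [set x | W (act x m)].
Proof.
move=> [W0 WD]; split=> [|a x y Wx Wy]; first by rewrite /= act0l.
by rewrite /= actPl; apply: WD.
Qed.

Lemma subspace_orbit (W : set (ghat R)) m :
  subspace W -> subspace [set act x m | x in W].
Proof.
move=> [W0 WD]; split; first by exists 0 => //; exact: act0l.
move=> a _ _ [x Wx <-] [y Wy <-]; exists (a *: x + y); first exact: WD.
exact: actPl.
Qed.

Lemma lowered_deg (v : M) j m : lowered v j m -> j <= 0 /\ (j = 0 -> m = v).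
Proof.
by elim=> [|k x {}j {}m k0 _ _ [j0 mv]]; [split|split; lia].
Qed.

Lemma lowered_deg1 (v : M) j m :
  lowered v j m -> j = -1 -> exists2 x, ghat_deg (-1) x & m = act x v.
Proof.
case=> // k x {}j {}m k0 degx /lowered_deg[j0 mv] kj.
have k1 : k = -1 by lia.
by exists x; rewrite -?k1// mv//; lia.
Qed.

Variables (xi : {linear ghat0 R -> C^o}) (v : M).

(** Each factor of a monomial has degree at most -1, so degree -1 leaves room for one factor only;
    these vectors already form a subspace. *)
Lemma mod_deg1 : mod_deg v (-1) = [set act x v | x in @ghat_deg R (-1)].
Proof.
rewrite -[RHS](lspan_id (subspace_orbit _ (ghat_deg_subspace _ _))).
congr lspan; apply/seteqP; split=> [m lowm|_ [x degx <-]].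
  by have [x degx ->] := lowered_deg1 lowm erefl; exists x.
by rewrite -[-1]addr0; apply: lowered_cons => //; apply: lowered_nil.
Qed.

Hypothesis hw : highest_weight_vector xi v.

Lemma hwP : [/\ v <> 0,
      forall h : ghat0 R, act (val h) v = (xi h : C) *: v,
      forall k x, 0 < k -> ghat_deg k x -> act x v = 0
    & Uneg v = setT].
Proof.
case: hw => v0 xiv posv negv; split=> // k x k0 degx.
by apply: posv; apply: lspan_incl; exists k.
Qed.

Lemma hw_scal0 a : a *: v = 0 -> a = 0.
Proof.
have [v0 _ _ _] := hwP; move=> /eqP; rewrite scaler_eq0 => /orP[/eqP//|/eqP].
by move/v0.
Qed.

Definition hdiag (a : int -> C) (d : C) : ghat0 R :=
  insubd 0 ((gldiag 0 a, d) : ghat R).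

Lemma val_hdiag a d : val (hdiag a d) = (gldiag 0 a, d).
Proof. by rewrite insubdK//; apply/mem_set; split=> //; apply: gldiag_deg. Qed.

Lemma hdiag_eta (h : ghat0 R) : h = hdiag (fun j => omega j h) (Lambda0 h).
Proof.
apply/val_inj; rewrite val_hdiag [LHS]surjective_pairing; congr pair.
have /set_mem[degh _] := valP h; rewrite [LHS](gl_degE degh).
by apply: gl_ext => i j /=; rewrite subr0.
Qed.

(* The anticommutator of the given diagonal with a diagonal of degree 1 is
   [hdiag (fun j => c j + c (j - 1)) 0]; it kills [v] because both do. *)
Lemma weight_annihilator (p c : int -> C) (N : nat) :
  act (ghdiag (-1) p) v = 0 -> (forall j, N%:Z < `|j| -> p j != 0) ->
  (forall j, `|j| <= N%:Z -> c j = 0) ->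
  xi (hdiag (fun j => c j + c (j - 1)) 0) = 0.
Proof.
move=> pv pN cN; have [v0 xiv posv _] := hwP.
(* Chosen so that [b (j + 1) * p j = c j]; where [p] might vanish, [c] does too. *)
pose b j := c (j - 1) / p (j - 1).
have bp j : b (j + 1) * p j = c j.
  rewrite /b addrK; have [jN|Nj] := lerP `|j| N%:Z.
    by rewrite cN// !mul0r.
  by rewrite divfK// pN.
have deg1 := ghdiag_deg 1 b; have degN1 := ghdiag_deg (-1) p.
have := act_bracket v deg1 degN1.
rewrite pv (posv _ _ _ deg1)// !act0r scaler0 subr0.
suff -> : ghat_bracket (ghdiag 1 b) (ghdiag (-1) p) =
          val (hdiag (fun j => c j + c (j - 1)) 0).
  by rewrite xiv; apply: hw_scal0.
have [deg1' _] := deg1; have [degN1' _] := degN1.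
rewrite val_hdiag [LHS]surjective_pairing; congr pair.
  apply: gl_ext => i j; rewrite (gl_bracketE _ _ deg1' degN1') /=.
  rewrite expr1 mulN1r opprK.
  have [/eqP ij|ij] := boolP (j - i == 0); last first.
    have -> : (j - (i + 1) == -1) = false by lia.
    have -> : (j - (i + -1) == 1) = false by lia.
    by rewrite !mulr0 addr0.
  have -> : j = i by lia.
  rewrite !ifT; try lia.
  rewrite bp; have := bp (i - 1); rewrite subrK => <-.
  by rewrite [X in _ + X]mulrC.
(* Only [r = 0] has [r] and [r + 1] on opposite sides of the cut, and [c 0 = 0]. *)
rewrite /= (gl_cocycleE _ deg1'); apply: fsbig1 => r _ /=.
rewrite !ifT; try lia.
rewrite -mulrA bp; have [->|r0] := eqVneq r 0; first by rewrite cN ?mulr0.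
rewrite (_ : (r + 1 <= 0) = (r <= 0)); last lia.
by rewrite subrr mul0r mulr0.
Qed.

Lemma weight_far_eq0 (N : nat) p :
  act (ghdiag (-1) p) v = 0 -> (forall j, N%:Z < `|j| -> p j != 0) ->
  forall a, (forall j, `|j| <= N%:Z -> a j = 0) -> xi (hdiag a 0) = 0.
Proof.
move=> pv pN a /alternating_primitive[c ca cN].
rewrite -[RHS](weight_annihilator pv pN cN); congr (xi (hdiag _ _)).
by apply/funext => j; rewrite ca.
Qed.

Lemma findim_annihilator : findim [set act x v | x in @ghat_deg R (-1)] ->
  exists (p : int -> C) (N : nat),
    act (ghdiag (-1) p) v = 0 /\ forall j, N%:Z < `|j| -> p j != 0.
Proof.
move=> [s sE].
(* The exponents [0, ..., size s] give one vector more than there are generators; a relation among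
   them is a polynomial in [j]. *)
pose w (i : 'I_(size s).+1) := act (ghdiag (-1) (fun j => j%:~R ^+ i)) v.
have ws i : lspan [set` s] (w i).
  rewrite -sE; exists (ghdiag (-1) (fun j => j%:~R ^+ i)) => //.
  exact: ghdiag_deg.
have [a [i ai] aw] := dependent_images (ltnSn _) ws.
pose q := \poly_(k < (size s).+1) a (inord k).
have qE j : q.[j%:~R] = \sum_i a i * j%:~R ^+ i.
  by rewrite horner_poly; apply: eq_bigr => k _; rewrite inord_val.
have q0 : q != 0.
  apply: contra_neq ai => /polyP/(_ i).
  by rewrite coef_poly ltn_ord inord_val coef0.
have [N qN] := poly_int_roots_bounded q0.
exists (fun j => q.[j%:~R]), N; split=> //; rewrite -[RHS]aw.
have -> : (fun j => q.[j%:~R]) = fun j : int => \sum_i a i * j%:~R ^+ i.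
  by apply/funext => j; rewrite qE.
rewrite -ghdiag_sum act_suml; apply: eq_bigr => k _; exact: actZl.
Qed.

Lemma hdiag_linear e a b d f :
  hdiag (fun j => e * a j + b j) (e * d + f) = e *: hdiag a d + hdiag b f.
Proof.
apply/val_inj; transitivity (e *: val (hdiag a d) + val (hdiag b f)) => //.
rewrite !val_hdiag; congr pair.
apply: gl_ext => i j /=; rewrite !fctE /=; case: ifP => // _.
by rewrite scaler0 addr0.
Qed.

(** [xi] is linear but need not respect infinite sums, so coordinates can be expanded only over a
    finite list. *)
Lemma weight_sum (r : seq int) (a : int -> C) : uniq r ->
  xi (hdiag (fun j => if j \in r then a j else 0) 0) =
    \sum_(s <- r) xi (hdiag (fun j => (j == s)%:R) 0) * a s.
Proof.
elim: r => [_|s r IHr /andP[sr /IHr {}IHr]].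
  rewrite big_nil -[RHS](linear0 xi); congr (xi _); apply/val_inj.
  transitivity (0 : ghat R) => //; rewrite val_hdiag; congr pair.
  by apply: gl_ext => i j /=; case: ifP.
rewrite big_cons -IHr mulrC -[X in X + _](linearZ_LR xi) -linearD -hdiag_linear.
rewrite mulr0 addr0; congr (xi (hdiag _ _)); apply/funext => j.
rewrite inE; have [->|js] := eqVneq j s; last by rewrite mulr0 add0r.
by rewrite (negbTE sr) mulr1 addr0.
Qed.

Lemma weight_finite (N : nat) :
  (forall a, (forall j, `|j| <= N%:Z -> a j = 0) -> xi (hdiag a 0) = 0) ->
  exists N : nat, (0 < N)%N /\
    exists (xi_ : int -> R[i]) (d : R[i]), forall h : ghat0 R,
      xi h = \sum_(j \in [set j : int | `|j| <= 2 * N%:Z])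
               xi_ j * omega j h + d * Lambda0 h.
Proof.
move=> far0; exists N.+1; split=> //.
exists (fun s => xi (hdiag (fun j => (j == s)%:R) 0)), (xi (hdiag (fun=> 0) 1)).
move=> h.
have [r uniq_r mem_r] := int_ball (2 * N.+1).
rewrite (_ : [set j : int | _] = [set` r]); last first.
  by apply/seteqP; split=> j /=; rewrite mem_r.
rewrite -fsbig_seq// -weight_sum// {1}(hdiag_eta h).
(* The diagonal splits into its restriction to the window and [out], which the weight kills. *)
pose out j := if j \in r then 0 else omega j h.
have xi_out : xi (hdiag out 0) = 0.
  by apply: far0 => j jN; rewrite /out mem_r ifT//; lia.
rewrite -[RHS]addr0 -[X in _ + X]xi_out mulrC -[X in _ + X + _](linearZ_LR xi).
rewrite -addrA -!linearD -[in X in _ + X]hdiag_linear.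
rewrite -[X in X + _]scale1r -hdiag_linear.
rewrite mul1r add0r mulr1 addr0; congr (xi (hdiag _ _)); apply/funext => j.
by rewrite mul1r mulr0 add0r /out; case: ifP; rewrite ?addr0 ?add0r.
Qed.

End HighestWeight.

(** * Quasi-finiteness of irreducible modules *)

Section Irreducible.
Context (R : realType) (M : ghat_module R).
Local Notation C := R[i].
Implicit Types (x y : ghat R) (m : M).

Lemma mod_part_subspace t : subspace (@mod_part R M t).
Proof. exact/subspaceP/mod_part_submod. Qed.

Lemma mod_part_exists m : exists m0 m1 : M,
  [/\ mod_part false m0, mod_part true m1 & m = m0 + m1].
Proof. by have [[m0 m1] [[]]] := mod_part_direct m; exists m0, m1. Qed.

Lemma mod_part_uniq m0 m1 n0 n1 :
  mod_part false m0 -> mod_part true m1 ->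
  mod_part false n0 -> mod_part true n1 ->
  m0 + m1 = n0 + n1 -> m0 = n0 /\ m1 = n1.
Proof.
move=> m0P m1P n0P n1P e; have [p [_ pE]] := mod_part_direct (m0 + m1).
have := pE (m0, m1); rewrite (pE (n0, n1)) => [mn|]; last by split.
by have [] : (n0, n1) = (m0, m1); [apply: mn; split | move=> -> ->].
Qed.

Definition homog : set (ghat R) := [set x | exists k, ghat_deg k x].

Lemma foldr_actP (s : seq (ghat R)) a m n :
  foldr (@act R M) (a *: m + n) s =
    a *: foldr (@act R M) m s + foldr (@act R M) n s.
Proof. by elim: s => //= x s ->; rewrite actP. Qed.

Lemma foldr_act0 (s : seq (ghat R)) : foldr (@act R M) 0 s = 0.
Proof. by elim: s => //= x s ->; rewrite act0r. Qed.

Lemma foldr_act_part (s : seq (ghat R)) : (forall x, x \in s -> homog x) ->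
  exists p, forall t m, mod_part t m -> mod_part (t (+) p) (foldr (@act R M) m s).
Proof.
elim: s => [_|x s IHs homog_s].
  by exists false => t m; rewrite addbF.
have [p sp] := IHs (fun y ys => homog_s y (mem_behead (s := x :: s) ys)).
have [k degx] := homog_s x (mem_head x s).
exists (p (+) oddz k) => t m tm /=; rewrite addbA.
by apply: act_part => //; apply: sp.
Qed.

Lemma ghat_act_ind (W : set M) m : subspace W ->
  (forall k x, ghat_deg k x -> W (act x m)) -> forall x, W (act x m).
Proof.
move=> subW Wm x;
apply: (lspan_min (subspace_orbit_preim m subW)) (ghat_homog_sum x).
by move=> y [k degy]; apply: Wm degy.
Qed.

Variables (xi : {linear ghat0 R -> C^o}) (v : M).
Hypothesis hw : highest_weight_vector xi v.

Lemma hw_deg0 x (degx : ghat_deg 0 x) : act x v = xi (Ghat0 (mem_set degx)) *: v.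
Proof. by have [_ <- _ _] := hwP hw. Qed.

(** * The degree operator and its range *)

(** The grading element shifted by its eigenvalue on [v]: it acts on monomials of degree [j] by
    [- j], so by 0 on [v]. *)
Definition euler m : M := act (grading R) m - xi (hdiag (fun j => j%:~R) 0) *: m.

Lemma eulerP a m n : euler (a *: m + n) = a *: euler m + euler n.
Proof.
by rewrite /euler actP scalerDr opprD addrACA scalerBr !scalerA mulrC.
Qed.

Lemma euler0 : euler 0 = 0.
Proof. by rewrite /euler act0r scaler0 subrr. Qed.

Lemma subspace_euler_range : subspace (range euler).
Proof.
split; first by exists 0 => //; apply: euler0.
by move=> a _ _ [m _ <-] [n _ <-]; exists (a *: m + n) => //; apply: eulerP.
Qed.

Lemma euler_part t m : mod_part t m -> mod_part t (euler m).
Proof.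
move=> tm; apply: subspaceD; first exact: mod_part_subspace.
  rewrite -[t]addbF; apply: (act_part (k := 0)) => //; exact: ghdiag_deg.
apply: subspaceN; first exact: mod_part_subspace.
by apply: subspaceZ => //; apply: mod_part_subspace.
Qed.

Lemma euler_act k x m : k != 0 -> ghat_deg k x ->
  euler (act x m) = (- k)%:~R *: act x m + act x (euler m).
Proof.
move=> k0 degx.
have := act_bracket m (ghdiag_deg 0 (fun j => j%:~R)) degx.
rewrite (grading_bracket k0 degx) actZl expr0 scale1r => /esym/eqP.
rewrite subr_eq /euler => /eqP ->.
by rewrite actDr actNr actZr addrA.
Qed.

Lemma euler_lowered j m : lowered v j m -> euler m = (- j)%:~R *: m.
Proof.
elim=> [|k x {}j {}m k0 degx _ IHm].
  have [_ xiv _ _] := hwP hw; rewrite oppr0 scale0r /euler.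
  have := xiv (hdiag (fun j => j%:~R) 0); rewrite val_hdiag => ->.
  exact: subrr.
rewrite (euler_act _ _ degx) ?lt_eqF// IHm actZr -scalerDl.
by rewrite -intrD opprD.
Qed.

(** The operator [(euler - 1) ... (euler - n)]: it kills the monomials of degrees [- n] to [-1] and
    multiplies [v] by [n!] up to sign. *)
Fixpoint euler_prod (n : nat) m : M :=
  if n is k.+1 then euler (euler_prod k m) - n%:R *: euler_prod k m else m.

Lemma euler_prodP n a m m' :
  euler_prod n (a *: m + m') = a *: euler_prod n m + euler_prod n m'.
Proof.
elim: n => //= n ->; rewrite eulerP scalerBr [n.+1%:R *: (_ + _)]scalerDr.
by rewrite opprD addrACA !scalerA [a * _]mulrC.
Qed.

Lemma euler_prod0 n : euler_prod n 0 = 0.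
Proof. by elim: n => //= n ->; rewrite euler0 scaler0 subrr. Qed.

Lemma euler_prod_eigen n e m : euler m = e *: m ->
  euler_prod n m = (\prod_(k < n) (e - k.+1%:R)) *: m.
Proof.
move=> em; elim: n => [|n IHn] /=; first by rewrite big_ord0 scale1r.
rewrite IHn -[in euler _](addr0 (_ *: m)) eulerP euler0 addr0 em.
by rewrite scalerA scalerA -scalerBl big_ord_recr/= mulrBr [_ * n.+1%:R]mulrC.
Qed.

(** [Uneg] allows inhomogeneous factors; multilinearity expands them into homogeneous monomials. *)
Lemma lowered_span m : lspan [set m | exists j, lowered v j m] m.
Proof.
have [_ _ _ negv] := hwP hw; have : Uneg v m by rewrite negv.
set L := lspan _; have subL : subspace L by exact: lspan_subspace.
apply: lspan_min => // _ [s negs <-].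
elim: s negs => [_|x s IHs negs] /=.
  by apply: lspan_incl; exists 0; apply: lowered_nil.
have {}IHs := IHs (fun y ys => negs y (mem_behead (s := x :: s) ys)).
apply: (lspan_min (subspace_orbit_preim _ subL)) (negs x (mem_head x s)).
move=> y [k k0 degy]; apply: (lspan_min (subspace_act_preim y subL)) IHs.
move=> n [j lown]; apply: lspan_incl; exists (k + j); exact: lowered_cons.
Qed.

(** Every vector in the range of [euler] is killed by [euler_prod n] for large [n]: degree 0 dies
    under [euler], each other degree under one factor. On [v] the product is a non-zero scalar. *)
Lemma hw_notin_euler_range : ~ range euler v.
Proof.
pose K := [set m | exists n, forall n', (n <= n')%N -> euler_prod n' m = 0].
have subK : subspace K.
  split; first by exists 0%N => n _; apply: euler_prod0.
  move=> a m m' [n nm] [n' nm']; exists (maxn n n') => k.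
  rewrite geq_max => /andP[nk n'k].
  by rewrite euler_prodP nm// nm'// scaler0 addr0.
have eulerK m : K (euler m).
  have subK' : subspace [set m | K (euler m)].
    split; first by rewrite /= euler0; case: subK.
    by move=> a u w Ku Kw; rewrite /= eulerP; case: subK => _; apply.
  apply: (lspan_min subK') (lowered_span m) => n [j lown] /=.
  rewrite (euler_lowered lown); have [j0 _] := lowered_deg lown.
  have [->|jn0] := eqVneq j 0; first by rewrite scale0r; case: subK.
  apply: subspaceZ => //; exists (absz j) => n' jn'.
  rewrite (euler_prod_eigen _ (euler_lowered lown)).
  have ltj : ((absz j).-1 < n')%N by lia.
  have jE : (- j)%:~R = (absz j).-1.+1%:R :> C.
    by rewrite pmulrn; congr (_%:~R); lia.
  by rewrite (bigD1 (Ordinal ltj))//= jE subrr mul0r scale0r.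
move=> [m _ mv]; have [n nv] := eulerK m; rewrite mv in nv.
have := nv n (leqnn _);
rewrite (euler_prod_eigen _ (euler_lowered (lowered_nil v))).
move/(hw_scal0 hw)/eqP; apply/negP/prodf_neq0 => k _.
by rewrite oppr0 sub0r oppr_eq0 pnatr_eq0.
Qed.

Hypothesis irrM : irreducible_module M.

(* Otherwise these vectors would generate a graded submodule inside the range of
   [euler], which misses [v]. *)
Lemma irreducible_eq0 m :
  (forall s : seq (ghat R), (forall x, x \in s -> homog x) ->
    range euler (foldr (@act R M) m s)) -> m = 0.
Proof.
have subE := subspace_euler_range.
pose W := [set m | forall s : seq (ghat R), (forall x, x \in s -> homog x) ->
  range euler (foldr (@act R M) m s)].
have subW : subspace W.
  split=> [s _|a u w Wu Ww s hs]; first by rewrite foldr_act0; case: subE.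
  by rewrite foldr_actP; case: subE => _; apply; [apply: Wu | apply: Ww].
suff submodW : submodule W.
  case: irrM => _ /(_ W submodW)[W0|WT].
    by move=> Wm; have : W m := Wm; rewrite W0.
  have [] := hw_notin_euler_range; have Wv : W v by rewrite WT.
  exact: (Wv [::]).
split; first exact: (subspaceP W).1.
- move=> {}m Wm; have [m0 [m1 [m0P m1P mE]]] := mod_part_exists m.
  (* The word [s] shifts parity by some [p] and [euler] preserves it, so comparing parity components
     of the image of [m] and of [euler u] gives both preimages. *)
  suff W01 s : (forall x, x \in s -> homog x) ->
      range euler (foldr (@act R M) m0 s) /\ range euler (foldr (@act R M) m1 s).
    by exists m0, m1; split=> //; split=> // s hs; case: (W01 s hs).
  move=> hs; have [p sp] := foldr_act_part hs.
  have [u _ uE] := Wm s hs; have [u0 [u1 [u0P u1P u01]]] := mod_part_exists u.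
  have sE : foldr (@act R M) m0 s + foldr (@act R M) m1 s = euler u0 + euler u1.
    rewrite -[euler u0]scale1r -eulerP scale1r -u01 uE mE.
    by rewrite -[in RHS](scale1r m0) foldr_actP scale1r.
  have := sp _ _ m0P; have := sp _ _ m1P.
  have := euler_part u0P; have := euler_part u1P.
  case: (p) => /= e1 e0 s1 s0.
    have [-> ->] := mod_part_uniq s1 s0 e0 e1 (etrans (addrC _ _) sE).
    by split; [exists u1 | exists u0].
  have [-> ->] := mod_part_uniq s0 s1 e0 e1 sE.
  by split; [exists u0 | exists u1].
- move=> x {}m Wm; apply: ghat_act_ind => // k {}x degx s hs.
  rewrite -foldr_rcons; apply: Wm => y; rewrite mem_rcons inE.
  by move=> /predU1P[->|/hs//]; exists k.
Qed.


(** * Finiteness for finitely supported weights *)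

Variable n : nat.
Hypothesis n_gt0 : (0 < n)%N.
Hypothesis xi_far : forall a : int -> C,
  (forall j, `|j| < n%:Z -> a j = 0) -> xi (hdiag a 0) = 0.

Definition far_image : set M :=
  [set m | exists k x, [/\ k < 0, ghat_deg k x, far n x.1 & m = act x v]].

Lemma far_image_stable l y m : 0 <= l -> ghat_deg l y -> far_image m ->
  lspan far_image (act y m).
Proof.
move=> l0 degy [k [x [k0 degx farx ->]]].
have [v0 _ posv _] := hwP hw; have subF := lspan_subspace far_image.
have Fxv : lspan far_image (act x v) by apply: lspan_incl; exists k, x.
(* [y x v] becomes the bracket applied to [v], plus or minus [x y v], where [y v] is a multiple of
   [v]. *)
have := act_bracket v degy degx => /esym/eqP; rewrite subr_eq => /eqP ->.
apply: subspaceD => //; last first.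
  apply: subspaceZ => //; have [l_gt0|] := ltP 0 l.
    by rewrite (posv _ _ l_gt0 degy) act0r; case: subF.
  move=> l_le0; have lE : l = 0 by lia.
  by rewrite lE in degy; rewrite (hw_deg0 degy) actZr; apply: subspaceZ.
have deg_yx := ghat_bracket_deg degy degx.
have [kl_gt0|kl_le0] := ltP 0 (l + k).
  by rewrite (posv _ _ kl_gt0 deg_yx); case: subF.
have [_ far_yx] : far n (gl_bracket x.1 y.1) /\ far n (gl_bracket y.1 x.1).
  by apply: far_bracket degx.1 degy.1 farx _ _ _ _; lia.
have [kl0|kl_neq0] := eqVneq (l + k) 0; last first.
  apply: lspan_incl; exists (l + k), (ghat_bracket y x); split=> //; lia.
(* A bracket of degree 0 acts by the weight: its diagonal vanishes near the origin, and its central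
   part is a cocycle with a far argument. *)
rewrite kl0 in deg_yx; rewrite (hw_deg0 deg_yx).
set h := Ghat0 _; rewrite (hdiag_eta h).
have -> : Lambda0 h = 0 by exact: gl_cocycle_far n_gt0 degy.1 farx.
rewrite xi_far ?scale0r; first by case: subF.
by move=> j jn; apply: far_yx; lia.
Qed.

Lemma lowered_trans j k m u : lowered v k m -> lowered m j u -> lowered v (j + k) u.
Proof.
move=> lowm; elim=> [|l x {}j {}u l0 degx _ IHu]; first by rewrite add0r.
by rewrite -addrA; apply: lowered_cons.
Qed.

(** The space [Q] is stable under homogeneous elements and lies in negative degrees, where [euler]
    acts on monomials by non-zero scalars; so [Q] is inside the range of [euler] and
    [irreducible_eq0] applies. *)
Lemma far_kill k x : k < 0 -> ghat_deg k x -> far n x.1 -> act x v = 0.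
Proof.
move=> k0 degx farx.
pose Q := lspan [set u | exists m j, far_image m /\ lowered m j u].
have subQ : subspace Q := lspan_subspace _.
have FQ : lspan far_image `<=` Q.
  by apply: lspan_mono => m Fm; exists m, 0; split=> //; apply: lowered_nil.
have Qneg l y u : l < 0 -> ghat_deg l y -> Q u -> Q (act y u).
  move=> l0 degy; apply: (lspan_min (subspace_act_preim y subQ)).
  move=> {}u [m [j [Fm lowu]]]; apply: lspan_incl; exists m, (l + j).
  by split=> //; apply: lowered_cons.
have Qhomog l y u : ghat_deg l y -> Q u -> Q (act y u).
  move=> degy; apply: (lspan_min (subspace_act_preim y subQ)).
  (* Induction on the monomial for all [y] at once, since commuting [y] past [z] also produces a
     bracket in its place. *)
  move=> {}u [m [j [Fm lowu]]] /=;
  elim: lowu l y degy => [|p z {}j {}u p0 degz lowu IHu] l y degy.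
    have [l0|l0] := ltP l 0; last first.
      by apply: FQ; apply: far_image_stable l0 degy Fm.
    apply: (Qneg l) => //; apply: FQ; exact: lspan_incl.
  have := act_bracket u degy degz => /esym/eqP; rewrite subr_eq => /eqP ->.
  apply: subspaceD => //; first by apply: IHu (ghat_bracket_deg degy degz).
  by apply: subspaceZ => //; apply: (Qneg p) => //; apply: IHu degy.
have QE : Q `<=` range euler.
  apply: lspan_min; first exact: subspace_euler_range.
  move=> u [_ [j [[p [z [p0 degz _ ->]]] lowu]]].
  have lowz : lowered v p (act z v).
    by rewrite -[p]addr0; apply: lowered_cons => //; apply: lowered_nil.
  have uE := euler_lowered (lowered_trans lowz lowu).
  have [j0 _] := lowered_deg lowu; exists ((- (j + p))%:~R^-1 *: u) => //.
  rewrite -[_ *: u]addr0 eulerP euler0 addr0 uE scalerA mulVf ?scale1r//.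
  by rewrite intr_eq0; lia.
apply: irreducible_eq0 => s hs; apply: QE.
elim: s hs => [_|y s IHs hs] /=.
  by apply: FQ; apply: lspan_incl; exists k, x.
have [l degy] := hs y (mem_head y s); apply: Qhomog degy _.
by apply: IHs => z zs; apply: hs; rewrite inE zs orbT.
Qed.

(** Commuting past a factor of degree [l] brings the support closer to the origin by at most [- l];
    over the monomial these losses add up to [|j|]. *)
Lemma far_kill_lowered j m : lowered v j m -> forall k x,
  k < 0 -> ghat_deg k x -> far (n + absz j) x.1 -> act x m = 0.
Proof.
elim=> [|l y {}j {}m l0 degy lowm IHm] k x k0 degx farx.
  by apply: far_kill k0 degx _; apply: far_le farx; lia.
have [j0 _] := lowered_deg lowm.
have := act_bracket m degx degy => /esym/eqP; rewrite subr_eq => /eqP ->.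
have [far_xy _] : far (n + absz j) (gl_bracket x.1 y.1) /\
    far (n + absz j) (gl_bracket y.1 x.1).
  by apply: far_bracket degx.1 degy.1 farx _ _ _ _; lia.
rewrite (IHm (k + l) (ghat_bracket x y))//; first last.
- exact: ghat_bracket_deg.
- lia.
rewrite (IHm k x) ?act0r ?scaler0 ?addr0//.
by apply: far_le farx; lia.
Qed.

(** Removing from [x] its columns in [r] leaves a far element, which kills [m]. In the bound, [- j]
    is the margin of [far_kill_lowered], and [- k] accounts for rows closer to the origin than their
    columns. *)
Lemma act_near j m : lowered v j m -> forall B (r : seq int), uniq r ->
  (forall i, (i \in r) = (`|i| <= B%:Z)) ->
  forall k x, k < 0 -> ghat_deg k x -> n%:Z - k - j <= B%:Z ->
  act x m =
    \sum_(i <- r) x.1 (i - k) i *: act (ghdiag k (fun s => (s == i)%:R)) m.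
Proof.
move=> lowm B r uniq_r mem_r k x k0 degx nB.
have [j0 _] := lowered_deg lowm.
under eq_bigr do rewrite -actZl.
rewrite -act_suml ghdiag_sum; apply/eqP; rewrite -subr_eq0 -[- act _ _]scaleN1r.
rewrite -actZl -actDl; apply/eqP; apply: (far_kill_lowered lowm k0).
  apply: subspaceD => //; first exact: ghat_deg_subspace.
  by apply: subspaceZ; [exact: ghat_deg_subspace | exact: ghdiag_deg].
move=> i l il; rewrite [LHS](_ : _ = x.1 i l - (if l - i == k then
  \sum_(p <- r) x.1 (p - k) p * (l == p)%:R else 0)); last first.
  by rewrite -[- (if _ then _ else _)]mulN1r.
case: eqP => [lk|/eqP lk]; last by rewrite subr0; apply: degx.1.
rewrite (bigD1_seq l)//=; last by rewrite mem_r; lia.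
rewrite eqxx mulr1 big1 ?addr0.
  by apply/eqP; rewrite subr_eq0; apply/eqP; congr (x.1 _ _); lia.
by move=> p pl; rewrite eq_sym (negbTE pl) mulr0.
Qed.

Lemma lowered_finite (N : nat) : exists s : seq M,
  (forall u, u \in s -> lowered v (- N%:Z) u) /\
  forall m, lowered v (- N%:Z) m -> lspan [set` s] m.
Proof.
elim/ltn_ind: N => N IHN.
have /choice[S SP] : forall N', exists s : seq M, (N' < N)%N ->
    (forall u, u \in s -> lowered v (- N'%:Z) u) /\
    forall m, lowered v (- N'%:Z) m -> lspan [set` s] m.
  move=> N'; have [/IHN[s sP]|NN'] := ltnP N' N; first by exists s.
  by exists [::].
(* The outer factor has degree [k] and the rest degree [j] with [k + j = - N], so the bound
   [n - k - j] equals [n + N]. *)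
have [r uniq_r mem_r] := int_ball (n + N).
pose e k i := ghdiag k (fun s => (s == i)%:R : C).
(* Degree 0 has only the empty monomial; below it, matrix units from the window are applied to the
   generators of the degrees already treated. *)
pose s := (if N == 0%N then [:: v] else [::]) ++
  [seq act (e (N'%:Z - N%:Z) p.1) p.2 |
     N' <- iota 0 N, p <- [seq (i, u) | i <- r, u <- S N']].
exists s; split.
  move=> u; rewrite mem_cat.
  move=> /orP[|/allpairsPdep[N' [[i w] [N'N /allpairsP[[i' w'] /=]]]]].
    by case: eqP => // ->; rewrite inE => /eqP ->; apply: lowered_nil.
  move=> [ir wS [-> ->]] ->; rewrite mem_iota in N'N.
  have [Slow _] := SP N' N'N.
  rewrite [X in lowered v X](_ : _ = (N'%:Z - N%:Z) + (- N'%:Z)); last lia.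
  by apply: lowered_cons; [lia | exact: ghdiag_deg | exact: Slow].
move=> m; move NJ: (- N%:Z) => J lowm.
case: lowm NJ => [|k x j {}m k0 degx lowm] NJ.
  have N0 : N = 0%N by lia.
  by apply: lspan_incl; rewrite /= /s N0 eqxx inE eqxx.
have [j0 _] := lowered_deg lowm.
have N'N : (absz j < N)%N by lia.
have jE : j = - (absz j)%:Z by lia.
have [Slow Sspan] := SP _ N'N; rewrite jE in lowm.
apply: (lspan_min (subspace_act_preim x (lspan_subspace _))) (Sspan _ lowm).
move=> u /= uS; rewrite (act_near (Slow u uS) uniq_r mem_r k0 degx); last lia.
rewrite big_seq; apply: subspace_sum; first exact: lspan_subspace.
move=> i ir; apply: subspaceZ; first exact: lspan_subspace.
apply: lspan_incl; rewrite /= mem_cat; apply/orP; right.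
rewrite (_ : k = (absz j)%:Z - N%:Z); last lia.
apply/allpairsPdep; exists (absz j), (i, u); rewrite mem_iota; split=> //.
by apply/allpairsP; exists (i, u).
Qed.

Lemma far_quasi_finite : quasi_finite v.
Proof.
move=> j; have [j0|j0] := ltP 0 j.
  apply: (findim_lspan (s := [::])) => m //= lowm.
  by have [] := lowered_deg lowm; lia.
have [s [slow sspan]] := lowered_finite (absz j).
rewrite (_ : j = - (absz j)%:Z); last lia.
by apply: (findim_lspan (s := s)) => // m ms; apply/lspan_incl/slow.
Qed.

End Irreducible.

Theorem theorem4p2 (R : realType) (M : ghat_module R)
    (xi : {linear ghat0 R -> R[i]^o}) (v : M) :
  irreducible_module M -> highest_weight_vector xi v ->
  [<-> quasi_finite v;
       findim [set act x v | x in ghat_deg (-1)];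
       exists N : nat, (0 < N)%N /\
         exists (xi_ : int -> R[i]) (d : R[i]), forall h : ghat0 R,
           xi h = \sum_(j \in [set j : int | `|j| <= 2 * N%:Z])
                    xi_ j * omega j h + d * Lambda0 h].
Proof.
move=> irrM hw; tfae.
- by move=> /(_ (-1)); rewrite mod_deg1.
- move=> /findim_annihilator[p [N [pv pN]]].
  exact: weight_finite (weight_far_eq0 hw pv pN).
- move=> [N [_ [xi_ [d xiE]]]].
  (* In doubled indices the weight is supported in [|j| <= 2 * N], that is [|j| < (2 * N).+1]. *)
  apply: (far_quasi_finite hw irrM (n := (2 * N).+1)) => // a a0.
  rewrite xiE /Lambda0 /omega val_hdiag /= mulr0 addr0; apply: fsbig1 => j jN.
  by rewrite subrr eqxx a0 ?mulr0//; move: jN => /=; lia.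
Qed.
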